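(* Let $\varphi \in L^\infty$. Then, for each orthonormal basis $\{f_i\}_{i=1}^n$ for the model space $\mathcal{K}_{B_n}$, the kernel space \[ \ker\Big(T_\varphi + \sum_{i=1}^{n} f_i \otimes T_z^* f_i\Big) \] is nearly $T^*_{z,B_n}$-invariant.
   Context: $H^2$ is the Hardy space on the open unit disc $\mathbb{D}$, regarded also as a closed subspace of $L^2(\mathbb{T})$, where $\mathbb{T}$ is the unit circle. $L^\infty$ is the space of essentially bounded functions on $\mathbb{T}$. For $\varphi\in L^\infty$ the Toeplitz operator is $T_\varphi f=P_{H^2}(\varphi f)$, $f\in H^2$, with $P_{H^2}$ the orthogonal projection of $L^2(\mathbb{T})$ onto $H^2$; in particular $T_zf=zf$, with adjoint $T_z^*$. For $u,v\in H^2$, $(u\otimes v)f=\langle f,v\rangle u$. Fix points $z_1,\ldots,z_n\in\mathbb{D}$ (possibly repeated) with $z_j=0$ for some $j$, and let $B_n(z)=\prod_{k=1}^n\frac{z_k-z}{1-\bar z_kz}$, so $B_n(0)=0$. The model space is $\mathcal{K}_{B_n}=H^2/B_nH^2$, identified with the orthogonal complement of $B_nH^2$ in $H^2$; it has dimension $n$. A closed subspace $\mathcal{M}\subseteq H^2$ is nearly $T^*_{z,B_n}$-invariant if $T_z^*f\in\mathcal{M}$ for all $f\in\mathcal{M}\cap B_nH^2$. *)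

(* Defs.v *)
From HB Require Import structures.
From mathcomp Require Import all_boot all_order all_algebra.
From mathcomp Require Import complex.
From mathcomp Require Import all_classical all_reals all_analysis.

Set Implicit Arguments.
Unset Strict Implicit.
Unset Printing Implicit Defensive.

Import Order.TTheory GRing.Theory Num.Theory.
Import numFieldNormedType.Exports.

Local Open Scope classical_set_scope.
Local Open Scope ring_scope.
Local Open Scope complex_scope.

Section Circle.
Variable R : realType.

Definition circle : Type := {z : R[i] | `|z| == 1}.

Lemma expi_subproof (t : R) : `|cos t +i* sin t| == 1 :> R[i].
Proof. by rewrite normc_def /= cos2Dsin2 sqrtr1. Qed.

Definition expi (t : R) : circle := exist _ (cos t +i* sin t) (expi_subproof t).

Lemma two_pi_gt0 : (0 : R) < pi *+ 2.
Proof. by rewrite pmulrn_lgt0 // pi_gt0. Qed.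

(* Normalized arc length on the circle, in the parametrization
   t |-> exp(it): the probability measure dt/(2 pi) on [0, 2 pi]. *)
Definition arc_measure := uniform_prob two_pi_gt0.

Definition cfun : Type := circle -> R[i].

(* Elements of L^2, L^infty, H^2 are represented by functions on the circle;
   [aeq] is equality of the represented elements. *)
Definition aeq (f g : cfun) : Prop :=
  {ae arc_measure, forall t, f (expi t) = g (expi t)}.

Definition in_Lp (p : \bar R) : set cfun :=
  [set f : cfun |
    (fun t => complex.Re (f (expi t))) \in Lfun arc_measure p /\
    (fun t => complex.Im (f (expi t))) \in Lfun arc_measure p].

Definition L2 : set cfun := in_Lp 2%:E.
Definition Linfty : set cfun := in_Lp +oo%E.

Definition mean (f : cfun) : R[i] :=
  Rintegral arc_measure setT (fun t => complex.Re (f (expi t)))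
  +i* Rintegral arc_measure setT (fun t => complex.Im (f (expi t))).

Definition inner (f g : cfun) : R[i] := mean (fun z => f z * (g z)^*).

Definition norm2 (f : cfun) : R := Num.sqrt (complex.Re (inner f f)).

Definition fourier (f : cfun) (k : int) : R[i] :=
  inner f (fun z => val z ^ k).

(* The Hardy space as a subspace of L^2 of the circle. *)
Definition H2 : set cfun :=
  [set f | L2 f /\ forall k : int, k < 0 -> fourier f k = 0].

Definition is_H2proj (g p : cfun) : Prop :=
  H2 p /\ forall h, H2 h -> inner (g \- p) h = 0.

(* The orthogonal projection of L^2 onto H2 (which exists, and is unique up to
   [aeq], for g in L2). *)
Definition H2proj (g : cfun) : cfun := xget (cst 0) (is_H2proj g).

Definition toeplitz (phi f : cfun) : cfun := H2proj (phi \* f).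

Definition is_adjoint_at (A : cfun -> cfun) (f g : cfun) : Prop :=
  H2 g /\ forall h, H2 h -> inner (A h) f = inner h g.

(* The Hilbert space adjoint of a bounded operator A on H2, evaluated at f in
   H2; unique up to [aeq]. *)
Definition adjoint (A : cfun -> cfun) (f : cfun) : cfun :=
  xget (cst 0) (is_adjoint_at A f).

Definition Tz (f : cfun) : cfun := fun z => val z * f z.

Definition Tz_adj : cfun -> cfun := adjoint Tz.

Definition tensor (u v f : cfun) : cfun := fun z => inner f v * u z.

Definition kernel_on_H2 (A : cfun -> cfun) : set cfun :=
  [set f | H2 f /\ aeq (A f) (cst 0)].

Definition blaschke n (a : 'I_n -> R[i]) (z : R[i]) : R[i] :=
  \prod_(k < n) ((a k - z) / (1 - (a k)^* * z)).

Definition BH2 n (a : 'I_n -> R[i]) : set cfun :=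
  [set f | L2 f /\
    exists2 h, H2 h & aeq f (fun z => blaschke a (val z) * h z)].

Definition model_space n (a : 'I_n -> R[i]) : set cfun :=
  [set f | H2 f /\ forall g, BH2 a g -> inner f g = 0].

Definition orthonormal_basis n (K : set cfun) (f : 'I_n -> cfun) : Prop :=
  [/\ forall i, K (f i),
      forall i j, inner (f i) (f j) = (i == j)%:R &
      forall g, K g ->
        exists c : 'I_n -> R[i], aeq g (fun z => \sum_(i < n) c i * f i z)].

Definition closed_subspace (M : set cfun) : Prop :=
  [/\ M `<=` L2,
      M (cst 0),
      forall (c : R[i]) f g, M f -> M g -> M (fun z => c * f z + g z) &
      forall f, L2 f ->
        (forall e : R, 0 < e -> exists2 g, M g & norm2 (f \- g) < e) -> M f].

Definition nearly_invariant n (a : 'I_n -> R[i]) (M : set cfun) : Prop :=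
  [/\ closed_subspace M, M `<=` H2 &
      forall f, M f -> BH2 a f -> M (Tz_adj f)].

End Circle.

(* Main.v *)
Require Import Defs.
From mathcomp Require Import all_boot all_order all_algebra.
From mathcomp Require Import complex.
From mathcomp Require Import all_classical all_reals all_analysis.
From mathcomp Require Import measurable_realfun ess_sup_inf.
From mathcomp Require Import ring lra.

(* Let M be the kernel and let f lie in both M and B_n H^2.  Since z f is again
   in B_n H^2, it is orthogonal to every f_i, so <f, T_z^* f_i> = <z f, f_i> = 0
   and the kernel equation reduces to T_phi f = 0, that is, phi f is orthogonal
   to H^2.  As B_n(0) = 0, T_z^* f is (conj z) f.  Then
   <T_z^* f, T_z^* f_i> = <f, f_i> = 0, and phi (conj z) f is orthogonal to h in
   H^2 because phi f is orthogonal to z h; hence T_z^* f is in M.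

   M is closed because it is the orthogonal complement in L^2 of the functions
   z^k (k < 0) and (conj phi) h + sum_i <h, f_i> T_z^* f_i (h in H^2).

   The projection onto H^2 exists because a minimizing sequence for the
   distance, chosen to converge fast, converges almost everywhere, and Fatou's
   lemma bounds the distance to the limit.  That dividing by 1 - (conj a) z
   preserves H^2 is read off a recurrence on the negative Fourier coefficients, so
   no density of polynomials is needed. *)

Set Implicit Arguments.
Unset Strict Implicit.
Unset Printing Implicit Defensive.

Import Order.TTheory GRing.Theory Num.Theory.
Import numFieldNormedType.Exports.
Local Open Scope classical_set_scope.
Local Open Scope ring_scope.
Local Open Scope complex_scope.

(** * Squared modulus on the complex numbers and on the circle *)

Section ComplexModulus.
Variable R : realType.
Implicit Types z w : R[i].

(** The norm of [R[i]] takes its values in [R[i]]; this real-valued polynomial in the two parts can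
    be measured and integrated directly. *)
Definition nsq z : R := complex.Re z ^+ 2 + complex.Im z ^+ 2.

Lemma cReD z w : complex.Re (z + w) = complex.Re z + complex.Re w.
Proof. by case: z w => [? ?] [? ?]. Qed.

Lemma cImD z w : complex.Im (z + w) = complex.Im z + complex.Im w.
Proof. by case: z w => [? ?] [? ?]. Qed.

Lemma cReM z w : complex.Re (z * w) =
  complex.Re z * complex.Re w - complex.Im z * complex.Im w.
Proof. by case: z w => [? ?] [? ?]. Qed.

Lemma cImM z w : complex.Im (z * w) =
  complex.Re z * complex.Im w + complex.Im z * complex.Re w.
Proof. by case: z w => [? ?] [? ?]. Qed.

Lemma cReJ z : complex.Re (z^*%R) = complex.Re z. Proof. by case: z. Qed.
Lemma cImJ z : complex.Im (z^*%R) = - complex.Im z. Proof. by case: z. Qed.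

Lemma eqc_ReIm z w :
  complex.Re z = complex.Re w -> complex.Im z = complex.Im w -> z = w.
Proof. by case: z w => [? ?] [? ?] /= -> ->. Qed.

Lemma nsq_ge0 z : 0 <= nsq z.
Proof. by rewrite addr_ge0 ?sqr_ge0. Qed.

Lemma nsqM z w : nsq (z * w) = nsq z * nsq w.
Proof. by rewrite /nsq cReM cImM; ring. Qed.

Lemma nsqJ z : nsq (z^*%R) = nsq z.
Proof. by rewrite /nsq cReJ cImJ sqrrN. Qed.

Lemma nsq_eq0 z : (nsq z == 0) = (z == 0).
Proof.
by rewrite /nsq paddr_eq0 ?sqr_ge0// !sqrf_eq0 eq_complex /=.
Qed.

Lemma nsqD_le z w : nsq (z + w) <= 2 * (nsq z + nsq w).
Proof.
rewrite /nsq cReD cImD.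
have := sqr_ge0 (complex.Re z - complex.Re w).
have := sqr_ge0 (complex.Im z - complex.Im w).
nra.
Qed.

Lemma nsqE z : (nsq z)%:C = z * z^*%R.
Proof.
by apply: eqc_ReIm; rewrite ?cReM ?cImM cReJ cImJ /= /nsq; ring.
Qed.

Lemma nsq_norm1 z : (nsq z == 1) = (`|z| == 1).
Proof.
rewrite -(@eqrXn2 _ 2 `|z| 1)// expr1n sqr_normc -nsqE.
by rewrite -[1 in RHS]/((1:R)%:C) (inj_eq (@complexI R)).
Qed.

Lemma nsq_circle (z : circle R) : nsq (val z) = 1.
Proof. by apply/eqP; rewrite nsq_norm1; exact: (svalP z). Qed.

Lemma nsq1_neq0 z : nsq z = 1 -> z != 0.
Proof. by move=> z1; rewrite -nsq_eq0 z1 oner_eq0. Qed.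

Lemma conj_nsq1 z : nsq z = 1 -> z^*%R = z^-1.
Proof.
move=> z1; apply: (mulfI (nsq1_neq0 z1)).
by rewrite -nsqE z1 divff// nsq1_neq0.
Qed.

Lemma nsq1 : nsq 1 = 1. Proof. by rewrite /nsq /= expr1n expr0n addr0. Qed.

Lemma nsqX z n : nsq (z ^+ n) = nsq z ^+ n.
Proof. by elim: n => [|n ih]; rewrite ?expr0 ?nsq1// !exprS nsqM ih. Qed.

Lemma circle_neq0 (z : circle R) : val z != 0.
Proof. exact/nsq1_neq0/nsq_circle. Qed.

Lemma conj_circle (z : circle R) : (val z)^*%R = (val z)^-1.
Proof. exact/conj_nsq1/nsq_circle. Qed.

Lemma nsq_exp_circle (z : circle R) (k : int) : nsq (val z ^ k) = 1.
Proof.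
case: k => n; first by rewrite -exprnP nsqX nsq_circle expr1n.
by rewrite NegzE -exprnN -exprVn -conj_circle nsqX nsqJ nsq_circle expr1n.
Qed.

End ComplexModulus.

(** * Measurability of functions on the circle *)

Section Measurability.
Variable R : realType.
Implicit Types f g : cfun R.

Definition mble f :=
  measurable_fun [set: R] (fun t => complex.Re (f (expi t))) /\
  measurable_fun [set: R] (fun t => complex.Im (f (expi t))).

Lemma mble_cst (c : R[i]) : mble (fun=> c).
Proof. by split; exact: measurable_cst. Qed.

Lemma mbleD f g : mble f -> mble g -> mble (fun z => f z + g z).
Proof.
move=> [fr fi] [gr gi]; split.
  by under eq_fun do rewrite cReD; exact: measurable_funD.
by under eq_fun do rewrite cImD; exact: measurable_funD.
Qed.

Lemma mbleM f g : mble f -> mble g -> mble (fun z => f z * g z).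
Proof.
move=> [fr fi] [gr gi]; split.
  by under eq_fun do rewrite cReM; apply: measurable_funB;
    exact: measurable_funM.
by under eq_fun do rewrite cImM; apply: measurable_funD; exact: measurable_funM.
Qed.

Lemma mbleJ f : mble f -> mble (fun z => (f z)^*%R).
Proof.
move=> [fr fi]; split; first by under eq_fun do rewrite cReJ.
by under eq_fun do rewrite cImJ; exact: measurableT_comp.
Qed.

Lemma mbleN f : mble f -> mble (fun z => - f z).
Proof.
move=> mf; under eq_fun do rewrite -mulN1r.
by apply: mbleM => //; exact: mble_cst.
Qed.

Lemma mbleB f g : mble f -> mble g -> mble (fun z => f z - g z).
Proof. by move=> mf mg; apply: mbleD => //; exact: mbleN. Qed.

Lemma mble_val : mble (fun z : circle R => val z).
Proof.
split; [exact: (continuous_measurable_fun (@continuous_cos R))|].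
exact: (continuous_measurable_fun (@continuous_sin R)).
Qed.

Lemma mble_exp (k : int) : mble (fun z : circle R => val z ^ k).
Proof.
have mX n : mble (fun z : circle R => val z ^+ n).
  elim: n => [|n ih]; first by under eq_fun do rewrite expr0; exact: mble_cst.
  by under eq_fun do rewrite exprS; apply: mbleM => //; exact: mble_val.
case: k => n; first exact: mX.
(* On the circle, negative powers are conjugates of positive ones. *)
under eq_fun do rewrite NegzE -exprnN -exprVn -conj_circle -rmorphXn.
exact/mbleJ/mX.
Qed.

Lemma mble_nsq f : mble f ->
  measurable_fun [set: R] (fun t => nsq (f (expi t))).
Proof.
by move=> [fr fi]; apply: measurable_funD; exact: measurable_funX.
Qed.

End Measurability.

(** * Square integrable and essentially bounded functions *)

Section SquareIntegrable.
Variable R : realType.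
Implicit Types f g h : cfun R.
Local Notation mu := (@arc_measure R).

#[global] Instance arc_ae_filter : Filter (almost_everywhere mu).
Proof. exact: (ae_filter_ringOfSetsType (uniform_prob (two_pi_gt0 R))). Qed.

Lemma arc_measureT : mu [set: R] = 1%E.
Proof. exact: (probability_setT (uniform_prob (two_pi_gt0 R))). Qed.

(** The squared L^2 norm as an extended real, meaningful before [f] is known to lie in [L2]. *)
Definition csq f : \bar R := (\int[mu]_t (nsq (f (expi t)))%:E)%E.

Lemma csq_ge0 f : (0 <= csq f)%E.
Proof. by apply: integral_ge0 => t _; rewrite lee_fin nsq_ge0. Qed.

Lemma emeasurable_nsq f : mble f ->
  measurable_fun [set: R] (fun t => (nsq (f (expi t)))%:E).
Proof. by move=> mf; apply/measurable_EFinP; exact: mble_nsq. Qed.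

Lemma Lfun2_sq_le f (u : R -> R) :
  measurable_fun [set: R] u -> (csq f < +oo)%E ->
  (forall t, u t ^+ 2 <= nsq (f (expi t))) -> mble f -> u \in Lfun mu 2%:E.
Proof.
move=> mU fy uf mf; rewrite inE; apply/andP; split; rewrite inE//=.
rewrite /finite_norm unlock; apply: poweR_lty.
apply: le_lt_trans fy; apply: ge0_le_integral => //.
- by move=> t _; exact: poweR_ge0.
- apply: (measurableT_comp (measurable_poweR _)).
  by apply: measurableT_comp => //; exact/measurable_EFinP.
- exact: emeasurable_nsq.
- move=> t _ /=; rewrite lee_fin powR_mulrn// real_normK ?num_real//.
Qed.

(** [nsq] is the sum of the squares of the two parts and dominates each of them, so its integral is
    finite exactly when both parts are square integrable. *)
Lemma L2P f : L2 f <-> mble f /\ (csq f < +oo)%E.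
Proof.
split=> [[fr fi]|[mf fy]].
  have mf : mble f.
    split; [move: fr|move: fi]; rewrite inE => /andP[]; by rewrite inE.
  split=> //.
  have /integrableP[_] :=
    integrableD measurableT (Lfun2_integrable_sqr fr) (Lfun2_integrable_sqr fi).
  apply: le_lt_trans; apply: ge0_le_integral => //.
  - by move=> t _; rewrite lee_fin nsq_ge0.
  - exact: emeasurable_nsq.
  - by move: (emeasurable_nsq mf); exact: measurableT_comp.
  - by move=> t _ /=; rewrite lee_fin ler_norm.
split; apply: (@Lfun2_sq_le f) => //; try (by case: mf).
  by move=> t; rewrite lerDl sqr_ge0.
by move=> t; rewrite lerDr sqr_ge0.
Qed.

Lemma L2_mble f : L2 f -> mble f. Proof. by case/L2P. Qed.

Lemma L2_lty f : L2 f -> (csq f < +oo)%E. Proof. by case/L2P. Qed.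

Lemma L2_le f g (c : R) : mble f -> L2 g -> 0 <= c ->
  {ae mu, forall t, nsq (f (expi t)) <= c * nsq (g (expi t))} -> L2 f.
Proof.
move=> mf /L2P[mg gy] c0 fg; apply/L2P; split=> //.
apply: (@le_lt_trans _ _ (c%:E * csq g)%E); last first.
  by rewrite lte_mul_pinfty.
rewrite -ge0_integralZl//; last 2 first.
- exact: emeasurable_nsq.
- by move=> t _; rewrite lee_fin nsq_ge0.
apply: ae_ge0_le_integral => //.
- by move=> t _; rewrite lee_fin nsq_ge0.
- exact: emeasurable_nsq.
- by move=> t _; rewrite lee_fin mulr_ge0// nsq_ge0.
- by apply: measurable_funeM; exact: emeasurable_nsq.
- by apply: filterS fg => t /=; rewrite lee_fin.
Qed.

Lemma csqD_le f g : mble f -> mble g ->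
  (csq (fun z => f z + g z)%R <= 2%:E * (csq f + csq g))%E.
Proof.
move=> mf mg.
have mf' := emeasurable_nsq mf; have mg' := emeasurable_nsq mg.
rewrite -ge0_integralD//; try by move=> t _; rewrite lee_fin nsq_ge0.
rewrite -ge0_integralZl//; last 2 first.
- exact: emeasurable_funD.
- by move=> t _; rewrite -EFinD lee_fin addr_ge0// nsq_ge0.
apply: ge0_le_integral => //.
- by move=> t _; rewrite lee_fin nsq_ge0.
- exact: (emeasurable_nsq (mbleD mf mg)).
- by apply: measurable_funeM; exact: emeasurable_funD.
- by move=> t _; rewrite -EFinD -EFinM lee_fin nsqD_le.
Qed.

Lemma L2D f g : L2 f -> L2 g -> L2 (fun z => f z + g z).
Proof.
move=> /L2P[mf fy] /L2P[mg gy]; apply/L2P; split; first exact: mbleD.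
apply: le_lt_trans (csqD_le mf mg) _.
by rewrite lte_mul_pinfty//; exact: lte_add_pinfty.
Qed.

Definition Bdd f := mble f /\ exists c : R,
  {ae mu, forall t, nsq (f (expi t)) <= c}.

Lemma Lfuny_bounded (u : R -> R) : u \in Lfun mu +oo%E ->
  exists2 c : R, 0 <= c & {ae mu, forall t, u t ^+ 2 <= c}.
Proof.
rewrite inE => /andP[_]; rewrite inE/= /finite_norm unlock.
(* The norm at exponent [+oo] is an essential supremum only under positive total mass, which here is
   1. *)
rewrite [X in (0 < X)%E]arc_measureT lte01 => /ess_supr_bounded[M ub].
exists (M ^+ 2); first exact: sqr_ge0.
apply: filterS ub => t /= utM.
by rewrite -[u t ^+ 2]ger0_norm ?sqr_ge0// normrX ler_sqr ?nnegrE//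
  (le_trans _ utM).
Qed.

Lemma Linfty_Bdd f : Linfty f -> Bdd f.
Proof.
move=> [fr fi]; split.
  by split; [move: fr|move: fi]; rewrite inE => /andP[]; rewrite inE.
have [c _ rc] := Lfuny_bounded fr; have [d _ id] := Lfuny_bounded fi.
exists (c + d); apply: filterS2 rc id => t rt it.
exact: lerD.
Qed.

Lemma L2_Bdd f g : Bdd f -> L2 g -> L2 (fun z => f z * g z).
Proof.
move=> [mf [c fc]] lg.
(* The bound in [Bdd] carries no sign, while [L2_le] asks for a nonnegative constant. *)
apply: (@L2_le _ g `|c|) => //; first exact/mbleM/L2_mble.
apply: filterS fc => t ft; rewrite nsqM ler_wpM2r ?nsq_ge0//.
exact: le_trans ft (ler_norm _).
Qed.

Lemma Bdd_const f (c : R) : mble f -> (forall z, nsq (f z) <= c) -> Bdd f.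
Proof. by move=> mf fc; split=> //; exists c; apply: nearW => t. Qed.

Lemma Bdd_cst (c : R[i]) : Bdd (fun=> c).
Proof. by apply: (@Bdd_const _ (nsq c)) => //; exact: mble_cst. Qed.

Lemma BddJ f : Bdd f -> Bdd (fun z => (f z)^*%R).
Proof.
move=> [mf [c fc]]; split; first exact: mbleJ.
by exists c; apply: filterS fc => t; rewrite nsqJ.
Qed.

Lemma Bdd_exp (k : int) : Bdd (fun z : circle R => val z ^ k).
Proof.
apply: (@Bdd_const _ 1); first exact: mble_exp.
by move=> z; rewrite nsq_exp_circle.
Qed.

Lemma Bdd_val : Bdd (fun z : circle R => val z).
Proof. exact: (Bdd_exp 1). Qed.

Lemma L2Z (c : R[i]) f : L2 f -> L2 (fun z => c * f z).
Proof. by apply: L2_Bdd; exact: Bdd_cst. Qed.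

Lemma L2N f : L2 f -> L2 (fun z => - f z).
Proof. by move=> lf; under eq_fun do rewrite -mulN1r; exact: L2Z. Qed.

Lemma L2B f g : L2 f -> L2 g -> L2 (fun z => f z - g z).
Proof. by move=> lf lg; apply: L2D => //; exact: L2N. Qed.

Lemma L2_cst (c : R[i]) : L2 (fun=> c).
Proof.
apply/L2P; split; first exact: mble_cst.
by rewrite /csq integral_cst// [X in (_ * X)%E]arc_measureT mule1 ltry.
Qed.

Lemma L2_exp (k : int) : L2 (fun z : circle R => val z ^ k).
Proof.
under eq_fun do rewrite -[_ ^ _]mulr1.
by apply: L2_Bdd; [exact: Bdd_exp|exact: L2_cst].
Qed.

Lemma L2_sum (I : finType) (F : I -> cfun R) :
  (forall i, L2 (F i)) -> L2 (fun z => \sum_i F i z).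
Proof.
move=> mF; elim: (index_enum I) => [|i s ih].
  by under eq_fun do rewrite big_nil; exact: L2_cst.
by under eq_fun do rewrite big_cons; exact: L2D.
Qed.

End SquareIntegrable.

(** * The inner product: sesquilinearity and definiteness *)

Section Inner.
Variable R : realType.
Implicit Types f g h : cfun R.
Local Notation mu := (@arc_measure R).

Definition cint f :=
  mu.-integrable setT (EFin \o (fun t => complex.Re (f (expi t)))) /\
  mu.-integrable setT (EFin \o (fun t => complex.Im (f (expi t)))).

Lemma L2_integrable f g (u : R -> R) : L2 f -> L2 g -> measurable_fun setT u ->
  (forall t, `|u t| <= nsq (f (expi t)) + nsq (g (expi t))) ->
  mu.-integrable setT (EFin \o u).
Proof.
move=> /L2P[mf fy] /L2P[mg gy] mU ule; apply/integrableP; split.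
  exact/measurable_EFinP.
apply: (@le_lt_trans _ _ (csq f + csq g)%E); last exact: lte_add_pinfty.
have mf' := emeasurable_nsq mf; have mg' := emeasurable_nsq mg.
rewrite -ge0_integralD//; try by move=> t _; rewrite lee_fin nsq_ge0.
apply: ge0_le_integral => //.
- by apply: measurableT_comp => //; exact/measurable_EFinP.
- exact: emeasurable_funD.
- by move=> t _; rewrite -EFinD /= lee_fin.
Qed.

(** Each product of parts satisfies 2|xy| <= x^2 + y^2, so both parts of the integrand are dominated
    by [nsq (f z) + nsq (g z)]. *)
Lemma cint_mulJ f g : L2 f -> L2 g -> cint (fun z => f z * (g z)^*%R).
Proof.
move=> lf lg.
have [m1 m2] := mbleM (L2_mble lf) (mbleJ (L2_mble lg)).
split; apply: (L2_integrable lf lg) => // t;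
  rewrite ?cReM ?cImM cReJ cImJ /nsq ler_norml;
  move: (complex.Re _) (complex.Im _) (complex.Re _) (complex.Im _) => x y u v.
  have := (sqr_ge0 (x - u), sqr_ge0 (x + u), sqr_ge0 (y - v), sqr_ge0 (y + v)).
  by move=> [[[? ?] ?] ?]; apply/andP; split; nra.
have := (sqr_ge0 (x - v), sqr_ge0 (x + v), sqr_ge0 (y - u), sqr_ge0 (y + u)).
by move=> [[[? ?] ?] ?]; apply/andP; split; nra.
Qed.

Lemma meanD f g : cint f -> cint g ->
  mean (fun z => f z + g z) = mean f + mean g.
Proof.
move=> [fr fi] [gr gi]; apply: eqc_ReIm; rewrite ?cReD ?cImD /=.
  by under eq_Rintegral do rewrite cReD; rewrite RintegralD.
by under eq_Rintegral do rewrite cImD; rewrite RintegralD.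
Qed.

Lemma integrableZR (c : R) (u : R -> R) : mu.-integrable setT (EFin \o u) ->
  mu.-integrable setT (EFin \o (fun t => c * u t)).
Proof. by move=> iu; exact: (integrableZl measurableT c iu). Qed.

Lemma meanZ (c : R[i]) f : cint f -> mean (fun z => c * f z) = c * mean f.
Proof.
move=> [fr fi]; apply: eqc_ReIm; rewrite ?cReM ?cImM /=.
  under eq_Rintegral do rewrite cReM.
  by rewrite RintegralB ?RintegralZl//; exact: integrableZR.
under eq_Rintegral do rewrite cImM.
by rewrite RintegralD ?RintegralZl//; exact: integrableZR.
Qed.

Lemma meanJ f : cint f -> mean (fun z => (f z)^*%R) = (mean f)^*%R.
Proof.
move=> [fr fi]; apply: eqc_ReIm; rewrite ?cReJ ?cImJ /=.
  by under eq_Rintegral do rewrite cReJ.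
under eq_Rintegral do rewrite cImJ -mulN1r.
by rewrite RintegralZl// mulN1r.
Qed.

Lemma mean_aeq f g : mble f -> mble g -> aeq f g -> mean f = mean g.
Proof.
move=> [fr fi] [gr gi] fg; apply: eqc_ReIm => /=; congr fine;
  apply: ae_eq_integral => //; try exact/measurable_EFinP;
  by apply: filterS fg => t /= ->.
Qed.

Lemma inner_aeql f f' g : L2 f -> L2 f' -> L2 g -> aeq f f' ->
  inner f g = inner f' g.
Proof.
move=> /L2_mble mf /L2_mble mf' /L2_mble/mbleJ mg ff'.
apply: mean_aeq; try exact: mbleM.
by apply: filterS ff' => t /= ->.
Qed.

Lemma innerDl f g h : L2 f -> L2 g -> L2 h ->
  inner (fun z => f z + g z) h = inner f h + inner g h.
Proof.
move=> lf lg lh; rewrite -meanD; try exact: cint_mulJ.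
by congr mean; apply/funext => z; rewrite mulrDl.
Qed.

Lemma innerZl (c : R[i]) f h : L2 f -> L2 h ->
  inner (fun z => c * f z) h = c * inner f h.
Proof.
move=> lf lh; rewrite -meanZ; last exact: cint_mulJ.
by congr mean; apply/funext => z; rewrite mulrA.
Qed.

Lemma innerC f g : L2 f -> L2 g -> inner g f = (inner f g)^*%R.
Proof.
move=> lf lg; rewrite -meanJ; last exact: cint_mulJ.
by congr mean; apply/funext => z; rewrite rmorphM /= conjCK mulrC.
Qed.

Lemma innerNl f h : L2 f -> L2 h -> inner (fun z => - f z) h = - inner f h.
Proof.
move=> lf lh; rewrite -mulN1r -innerZl//.
by congr inner; apply/funext => z; rewrite mulN1r.
Qed.

Lemma innerBl f g h : L2 f -> L2 g -> L2 h ->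
  inner (fun z => f z - g z) h = inner f h - inner g h.
Proof. by move=> lf lg lh; rewrite innerDl ?innerNl//; exact: L2N. Qed.

Lemma innerDr f g h : L2 f -> L2 g -> L2 h ->
  inner h (fun z => f z + g z) = inner h f + inner h g.
Proof.
move=> lf lg lh; rewrite innerC ?innerDl//; last exact: L2D.
by rewrite rmorphD /= -!innerC.
Qed.

Lemma innerZr (c : R[i]) f h : L2 f -> L2 h ->
  inner h (fun z => c * f z) = c^*%R * inner h f.
Proof.
move=> lf lh; rewrite innerC ?innerZl//; last exact: L2Z.
by rewrite rmorphM /= -innerC.
Qed.

Lemma inner0l h : inner (fun=> 0) h = 0.
Proof.
rewrite /inner (_ : (fun _ => _) = (fun=> 0)); last first.
  by apply/funext => z; rewrite mul0r.
by rewrite /mean /= Rintegral_cst// mul0r.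
Qed.

Lemma inner_suml (I : finType) (F : I -> cfun R) h :
  (forall i, L2 (F i)) -> L2 h ->
  inner (fun z => \sum_i F i z) h = \sum_i inner (F i) h.
Proof.
move=> lF lh.
(* The induction carries square integrability of the partial sums, which additivity requires. *)
suff [] : L2 (fun z => \sum_i F i z) /\
    inner (fun z => \sum_i F i z) h = \sum_i inner (F i) h by [].
elim: (index_enum I) => [|i s [ls ih]].
  rewrite big_nil -[RHS](inner0l h); under eq_fun do rewrite big_nil.
  by split; [exact: L2_cst|].
rewrite big_cons -ih -innerDl//; under eq_fun do rewrite big_cons.
by split; [exact: L2D|].
Qed.

(* [sqn f] is a junk value when [f] is not in [L2], whereas [csq f] is then
   [+oo] for measurable [f]. *)
Definition sqn f : R := complex.Re (inner f f).

Lemma sqnE f : L2 f -> (sqn f)%:E = csq f.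
Proof.
move=> lf; rewrite /sqn /inner /mean /= /Rintegral.
under eq_integral do rewrite -nsqE /=.
by rewrite fineK// ge0_fin_numE ?csq_ge0// L2_lty.
Qed.

Lemma sqn_ge0 f : L2 f -> 0 <= sqn f.
Proof. by move=> lf; rewrite -lee_fin sqnE// csq_ge0. Qed.

Lemma sqn_eq0 f : L2 f -> sqn f = 0 -> aeq f (cst 0).
Proof.
move=> lf n0; have f0 : csq f = 0%E by rewrite -sqnE// n0.
have mf := emeasurable_nsq (L2_mble lf).
have [f00 _] := ae_eq_integral_abs (uniform_prob (two_pi_gt0 R)) measurableT mf.
have : ae_eq (uniform_prob (two_pi_gt0 R)) setT
    (fun t => (nsq (f (expi t)))%:E) (cst 0%E).
  apply: f00; rewrite -[RHS]f0.
  by apply: eq_integral => t _; rewrite gee0_abs// lee_fin nsq_ge0.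
apply: filterS => t /= /(_ I)[] /eqP; rewrite nsq_eq0 => /eqP -> //.
Qed.


End Inner.

(** * Almost everywhere convergence from summable increments *)

Section FastConvergence.
Context d (T : measurableType d) (R : realType).
Variable mu : {measure set T -> \bar R}.

(** The telescoping series of increments converges absolutely by comparison with a geometric
    series. *)
Lemma is_cvg_geometric_increments (u : R ^nat) (C : R) :
  (forall n, `|u n.+1 - u n| <= C * 2^-1 ^+ n) -> cvgn u.
Proof.
move=> uC.
have C0 : 0 <= C.
  by have := le_trans (normr_ge0 _) (uC 0%N); rewrite expr0 mulr1.
suff : cvgn (series (telescope u)).
  move=> cu; have -> : u = (fun n => u 0%N + series (telescope u) n).
    by apply/funext => n; exact: eq_sum_telescope.
  by apply: is_cvgD => //; exact: is_cvg_cst.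
apply: normed_cvg; apply: (@series_le_cvg _ _ (geometric C 2^-1)).
- by move=> n; exact: normr_ge0.
- by move=> n; exact: geometric_ge0.
- by move=> n; exact: uC.
- by apply: is_cvg_geometric_series; rewrite ger0_norm// invf_lt1// ltr1n.
Qed.

Lemma ae_cvg_sqr_increments (u : nat -> T -> R) :
  (forall n, measurable_fun setT (u n)) ->
  (forall n, (\int[mu]_t ((u n.+1 t - u n t) ^+ 2)%:E <= (8^-1 ^+ n)%:E)%E) ->
  {ae mu, forall t, cvgn (u ^~ t)}.
Proof.
move=> mU uI.
(* The weights [4 ^ n] keep the sum of the squared increments integrable, and
   its finiteness at [t] makes the increments at [t] of order [2 ^- n]. *)
pose v n t : \bar R := (4 ^+ n * (u n.+1 t - u n t) ^+ 2)%:E.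
have v0 n t : (0 <= v n t)%E by rewrite lee_fin mulr_ge0 ?sqr_ge0 ?exprn_ge0.
have mv n : measurable_fun setT (v n).
  apply/measurable_EFinP; apply: measurable_funM => //.
  by apply: measurable_funX; exact: measurable_funB.
have mS : measurable_fun setT (fun t => \sum_(n <oo) v n t)%E.
  by apply: ge0_emeasurable_sum => // n t _ _.
have iS : mu.-integrable setT (fun t => \sum_(n <oo) v n t)%E.
  apply/integrableP; split => //.
  apply: (@le_lt_trans _ _ 2%:E); last exact: ltry.
  under eq_integral.
    by move=> t _; rewrite gee0_abs ?nneseries_ge0//; over.
  rewrite integral_nneseries//.
  apply: le_trans (@epsilon_trick0 R 2 xpredT _) => //.
  apply: lee_nneseries => [n _ _|n _]; first exact: integral_ge0.
  (* The weighted integrals are at most 4^n 8^(-n) = 2^(-n), and these bounds sum to 2. *)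
  have -> : 2 / (2 ^ n.+1)%:R = 4 ^+ n * 8^-1 ^+ n :> R.
    rewrite -exprMn (_ : 4 * 8^-1 = 2^-1 :> R); last by field.
    by rewrite natrX exprS invfM mulrA divff// mul1r exprVn.
  rewrite EFinM; apply: (@le_trans _ _ ((4 ^+ n)%:E *
      \int[mu]_t ((u n.+1 t - u n t) ^+ 2)%:E)%E); last first.
    by rewrite lee_pmul2l// lte_fin exprn_gt0.
  rewrite -ge0_integralZl//; last 2 first.
  - apply/measurable_EFinP.
    by apply: measurable_funX; exact: measurable_funB.
  - by move=> t _; rewrite lee_fin sqr_ge0.
have := integrable_ae measurableT iS.
apply: filterS => t /(_ I) St.
set S := (\sum_(n <oo) v n t)%E in St.
apply: (@is_cvg_geometric_increments _ (Num.sqrt (fine S))) => n.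
have vS : (v n t <= S)%E.
  have := @nneseries_lim_ge R (v ^~ t) xpredT 0 n.+1 (fun k _ _ => v0 k t).
  apply: le_trans; rewrite big_nat_recr//= leeDr//.
  by apply: sume_ge0 => k _.
move: vS; rewrite -(fineK St) lee_fin => vS.
(* Squared, the goal is the bound of the single term [v n t] by the sum [S]. *)
rewrite -(@ler_pXn2r _ 2)// ?nnegrE// ?mulr_ge0 ?sqrtr_ge0 ?exprn_ge0//.
have S0 : 0 <= fine S by apply/fine_ge0/nneseries_ge0.
rewrite exprMn sqr_sqrtr// real_normK ?num_real// -exprM mulnC exprM.
rewrite (_ : 2^-1 ^+ 2 = 4^-1 :> R); last by field.
by rewrite exprVn ler_pdivlMr ?exprn_gt0// mulrC.
Qed.

End FastConvergence.

(** * Hilbert space geometry: orthogonal complements and projections *)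

Section Hilbert.
Variable R : realType.
Implicit Types (f g h p q k : cfun R) (M S : set (cfun R)).
Local Notation mu := (@arc_measure R).

Lemma sqnN f : sqn (fun z => - f z) = sqn f.
Proof.
by congr (complex.Re (mean _)); apply/funext => z; rewrite rmorphN mulrNN.
Qed.

Lemma sqnD f g : L2 f -> L2 g ->
  sqn (fun z => f z + g z) = sqn f + sqn g + 2 * complex.Re (inner f g).
Proof.
move=> lf lg; rewrite /sqn innerDl// ?innerDr//; last exact: L2D.
by rewrite !cReD (innerC lf lg) cReJ; ring.
Qed.

Lemma sqnB f g : L2 f -> L2 g ->
  sqn (fun z => f z - g z) = sqn f + sqn g - 2 * complex.Re (inner f g).
Proof.
move=> lf lg; rewrite sqnD//; last exact: L2N.
rewrite sqnN (innerC (L2N lg) lf) innerNl// cReJ (innerC lf lg).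
by move: (inner f g) => [x y] /=; ring.
Qed.

Lemma sqnZ (c : R[i]) f : L2 f -> sqn (fun z => c * f z) = nsq c * sqn f.
Proof.
move=> lf; have lcf := L2Z c lf.
by rewrite /sqn innerZl// innerZr// mulrA -nsqE cReM /= mul0r subr0.
Qed.

Lemma parallelogram f g : L2 f -> L2 g ->
  sqn (fun z => f z - g z) + sqn (fun z => f z + g z) = 2 * (sqn f + sqn g).
Proof. by move=> lf lg; rewrite sqnB// sqnD//; ring. Qed.

(* Up to the [+ 1], which avoids a division by 0 when [k] vanishes, the
   coefficient is that of the orthogonal projection of [q] onto [k]. *)
Lemma sqn_sub_le q k : L2 q -> L2 k ->
  sqn (fun z => q z - ((sqn k + 1)^-1%:C * inner q k) * k z) <=
  sqn q - (sqn k + 1)^-1 * nsq (inner q k).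
Proof.
move=> lq lk; set s := (sqn k + 1)^-1.
have k1 : 0 < sqn k + 1 by rewrite ltr_wpDl// sqn_ge0.
rewrite sqnB//; last exact: L2Z.
rewrite sqnZ// innerZr//; set c := inner q k.
have -> : complex.Re ((s%:C * c)^*%R * c) = s * nsq c.
  by case: (c) => x y; rewrite rmorphM /nsq /=; ring.
have -> : nsq (s%:C * c) = s ^+ 2 * nsq c.
  by rewrite nsqM /nsq /= expr0n addr0.
have s0 : 0 < s by rewrite invr_gt0.
have sk : s * sqn k <= 1 by rewrite mulrC ler_pdivrMr// mul1r lerDl.
have : 0 <= s * nsq c * (1 - s * sqn k).
  by rewrite !mulr_ge0// ?nsq_ge0 ?subr_ge0// ltW.
nra.
Qed.

(** The left side of [sqn_sub_le] is nonnegative. The inflated constant is harmless, since only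
    continuity and boundedness of the inner product are drawn from it. *)
Lemma CauchySchwarz_weak q k : L2 q -> L2 k ->
  nsq (inner q k) <= (sqn k + 1) * sqn q.
Proof.
move=> lq lk; have k1 : 0 < sqn k + 1 by rewrite ltr_wpDl// sqn_ge0.
rewrite mulrC -ler_pdivrMr// mulrC -subr_ge0.
by apply: le_trans (sqn_sub_le lq lk); rewrite sqn_ge0//; apply/L2B/L2Z.
Qed.

(** Both [H2] and the kernel of the theorem are written in this form, which makes them closed
    subspaces at once. *)
Definition perp S : set (cfun R) :=
  [set f | L2 f /\ forall w, S w -> inner f w = 0].

Lemma perp_closed_subspace S : S `<=` @L2 R -> closed_subspace (perp S).
Proof.
move=> SL; split.
- by move=> f [].
- by split; [exact: L2_cst|move=> w Sw; exact: inner0l].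
- move=> c f g [lf f0] [lg g0]; split; first exact/L2D/lg/L2Z.
  move=> w Sw; have lw := SL _ Sw.
  rewrite innerDl// ?innerZl ?f0 ?g0 ?mulr0 ?addr0//; exact: L2Z.
- move=> f lf fapprox; split=> // w Sw; have lw := SL _ Sw.
  have w1 : 0 < sqn w + 1 by rewrite ltr_wpDl// sqn_ge0.
  apply/eqP; rewrite -nsq_eq0 eq_le nsq_ge0 andbT.
  apply/ler_addgt0Pr => e e0; rewrite add0r.
  (* This radius cancels the factor [sqn w + 1] of [CauchySchwarz_weak], so that
     [nsq (inner f w) <= e]. *)
  have [|g [lg g0] fg] := fapprox (Num.sqrt (e / (sqn w + 1))).
    by rewrite sqrtr_gt0 divr_gt0.
  have lfg := L2B lf lg.
  have -> : inner f w = inner (f \- g) w by rewrite innerBl// g0// subr0.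
  apply: le_trans (CauchySchwarz_weak lfg lw) _.
  rewrite mulrC -ler_pdivlMr//; apply: ltW.
  by move: fg; rewrite /norm2 ltr_sqrt// divr_gt0.
Qed.

Lemma cvg_nsqB (w z : R[i]) (u : nat -> R[i]) :
  complex.Re (u n) @[n --> \oo] --> complex.Re z ->
  complex.Im (u n) @[n --> \oo] --> complex.Im z ->
  nsq (w - u n) @[n --> \oo] --> nsq (w - z).
Proof.
move=> ur ui.
have nsqBE v : nsq (w - v) =
    (complex.Re w - complex.Re v) * (complex.Re w - complex.Re v) +
    (complex.Im w - complex.Im v) * (complex.Im w - complex.Im v).
  by case: w v => [a b] [c d]; rewrite /nsq /= !expr2.
under eq_fun do rewrite nsqBE.
by rewrite nsqBE; apply: cvgD; apply: cvgM; apply: cvgB => //; exact: cvg_cst.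
Qed.

(** Fatou's lemma passes bounds on the distance from [g] to the terms of the sequence on to its
    almost everywhere limit. The function [g] is arbitrary because it will be both the point to be
    projected and a term [h n] itself. *)
Lemma L2_fast_limit (h : nat -> cfun R) : (forall n, L2 (h n)) ->
  (forall n, sqn (fun z => h n.+1 z - h n z) <= 8^-1 ^+ n) ->
  exists2 p, mble p & forall g (c : R) N, mble g ->
    (forall n, (N <= n)%N -> (csq (fun z => g z - h n z)%R <= c%:E)%E) ->
    (csq (fun z => g z - p z)%R <= c%:E)%E.
Proof.
move=> lh hh.
have mh n := L2_mble (lh n).
have hh' n : (csq (fun z => h n.+1 z - h n z)%R <= (8^-1 ^+ n)%:E)%E.
  by rewrite -sqnE ?lee_fin//; exact: L2B.
(* Here [c] stands for either the real or the imaginary part. *)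
have cvg_part (c : R[i] -> R) : {morph c : z w / z - w} ->
    (forall z, c z ^+ 2 <= nsq z) ->
    (forall n, measurable_fun [set: R] (fun t => c (h n (expi t)))) ->
    {ae mu, forall t, cvgn (fun n => c (h n (expi t)))}.
  move=> cB c_le mc.
  apply: (@ae_cvg_sqr_increments _ _ _ (uniform_prob (two_pi_gt0 R))
    (fun n t => c (h n (expi t)))) => // n.
  apply: le_trans (hh' n); apply: ge0_le_integral => //.
  - by move=> t _; rewrite lee_fin sqr_ge0.
  - apply/measurable_EFinP; apply: measurable_funX.
    by apply: measurable_funB; exact: mc.
  - exact: (emeasurable_nsq (mbleB (mh n.+1) (mh n))).
  - by move=> t _; rewrite lee_fin -cB.
have cvgR : {ae mu, forall t, cvgn (fun n => complex.Re (h n (expi t)))}.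
  apply: cvg_part => [z w|z|n]; last by case: (mh n).
    by case: z w => [? ?] [? ?].
  by rewrite lerDl sqr_ge0.
have cvgI : {ae mu, forall t, cvgn (fun n => complex.Im (h n (expi t)))}.
  apply: cvg_part => [z w|z|n]; last by case: (mh n).
    by case: z w => [? ?] [? ?].
  by rewrite lerDr sqr_ge0.
(* An upper limit is defined and measurable everywhere, and it agrees with the limit wherever that
   exists; [fine] sends infinite values to 0. *)
pose p : cfun R := fun z =>
  fine (limn_esup (fun n => (complex.Re (h n z))%:E)) +i*
  fine (limn_esup (fun n => (complex.Im (h n z))%:E)).
have mp : mble p.
  split => /=.
    apply: measurableT_comp => //; apply: measurable_fun_limn_esup => n.
    by apply/measurable_EFinP; case: (mh n).
  apply: measurableT_comp => //; apply: measurable_fun_limn_esup => n.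
  by apply/measurable_EFinP; case: (mh n).
have limE (u : R ^nat) : cvgn u ->
    u n @[n --> \oo] --> fine (limn_esup (fun n => (u n)%:E)).
  move=> cu; have ue : (u n)%:E @[n --> \oo] --> (limn u)%:E 
    by apply: cvg_EFin => //; exact: nearW.
  by rewrite (cvg_limn_einf_sup ue).2 /=.
exists p => // g c N mg gh.
have mgp := emeasurable_nsq (mbleB mg mp).
have mgh n := emeasurable_nsq (mbleB mg (mh n)).
(* Almost everywhere convergence turns the integrand into a lower limit, the form in Fatou's
   lemma. *)
have -> : csq (fun z => g z - p z) = (\int[uniform_prob (two_pi_gt0 R)]_t
    limn_einf (fun n => (nsq (g (expi t) - h n (expi t)))%:E))%E.
  apply: ae_eq_integral => //.
    have -> : (fun t => limn_einf
          (fun n => (nsq (g (expi t) - h n (expi t)))%:E)) =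
        (fun t => - limn_esup
          (fun n => - (nsq (g (expi t) - h n (expi t)))%:E))%E.
      by apply/funext => t; rewrite (limn_esupN (fun n => (nsq _)%:E)) oppeK.
    apply: measurableT_comp => //; apply: measurable_fun_limn_esup => n.
    exact: measurableT_comp (mgh n).
  apply: filterS2 cvgR cvgI => t rt it _.
  apply/esym/(cvg_limn_einf_sup _).1; apply: cvg_EFin; first exact: nearW.
  have /= rt' := limE _ rt; have /= it' := limE _ it.
  exact: cvg_nsqB.
apply: (le_trans (fatou _ _ _ _)) => //.
  by move=> n t _; rewrite lee_fin nsq_ge0.
(* The lower limit is a limit of tail infima, each at most the term of index [maxn n N], where the
   bound is available. *)
rewrite limn_einf_lim; apply: lime_le; first exact: is_cvg_einfs.
apply: nearW => n; apply: le_trans (gh (maxn n N) (leq_maxr _ _)).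
by apply: ereal_inf_lbound; exists (maxn n N) => //=; exact: leq_maxl.
Qed.

Lemma closed_subspaceB M f g : closed_subspace M -> M f -> M g ->
  M (fun z => f z - g z).
Proof.
move=> [_ _ Mlin _] Mf Mg; have := Mlin (-1) g f Mg Mf.
by congr M; apply/funext => z; rewrite mulN1r addrC.
Qed.

Lemma closed_subspaceZ M (c : R[i]) f : closed_subspace M -> M f ->
  M (fun z => c * f z).
Proof.
move=> [_ M0 Mlin _] Mf; have := Mlin c f _ Mf M0.
by congr M; apply/funext => z; rewrite addr0.
Qed.

Lemma projection_exists M g : closed_subspace M -> L2 g ->
  exists2 p, M p & forall k, M k -> inner (g \- p) k = 0.
Proof.
move=> cM lg; have [ML M0 Mlin Mcl] := cM.
pose D := [set sqn (g \- h) | h in M].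
have D0 : lbound D 0.
  by move=> _ [h Mh <-]; apply: sqn_ge0; apply: L2B => //; exact: ML.
have infD : has_inf D.
  by split; [exists (sqn (g \- cst 0)), (cst 0)|exists 0].
set d := inf D.
have d_le h : M h -> d <= sqn (fun z => g z - h z).
  by move=> Mh; apply: (ge_inf infD.2); exists h.
(* The exponent is shifted so that [2 * (e n.+1 + e n) <= 8^-1 ^+ n], the rate asked for by
   [L2_fast_limit]. *)
pose e n : R := 8^-1 ^+ n.+1.
have e0 n : 0 < e n by rewrite exprn_gt0.
have /choice[h hP] n : exists h, M h /\ sqn (fun z => g z - h z) <= d + e n.
  have [_ [h Mh <-] hd] := inf_adherent (e0 n) infD.
  by exists h; split=> //; exact: ltW.
have lh n : L2 (h n) by apply: ML; exact: (hP n).1.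
have lgh n : L2 (fun z => g z - h n z) by exact: L2B.
(* Parallelogram law: the midpoint of [h m] and [h n] lies in [M], so its squared distance to [g] is
   at least [d]. *)
have dist m n : sqn (fun z => h m z - h n z) <= 2 * (e m + e n).
  have := parallelogram (lgh n) (lgh m).
  have -> : (fun z => g z - h n z - (g z - h m z)) = (fun z => h m z - h n z).
    by apply/funext => z; ring.
  have mid : M (fun z => 2^-1 * (h m z + h n z)).
    apply: closed_subspaceZ => //.
    have := Mlin 1 _ _ (hP m).1 (hP n).1.
    by congr M; apply/funext => z; rewrite mul1r.
  have -> : (fun z => g z - h n z + (g z - h m z)) =
      (fun z => 2 * (g z - 2^-1 * (h m z + h n z))).
    by apply/funext => z; field.
  rewrite sqnZ; last by apply: L2B => //; exact: ML.
  have -> : nsq (2 : R[i]) = 4 by rewrite /nsq /=; ring.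
  have := d_le _ mid; have := (hP m).2; have := (hP n).2.
  nra.
have hh n : sqn (fun z => h n.+1 z - h n z) <= 8^-1 ^+ n.
  apply: le_trans (dist _ _) _; rewrite /e !exprS.
  by have : 0 < 8^-1 ^+ n :> R by [rewrite exprn_gt0]; lra.
have [p mp pP] := L2_fast_limit lh hh.
have e_le m n : (m <= n)%N -> e n <= e m.
  move=> mn; apply: ler_wiXn2l => //; by rewrite invf_le1// ler1n.
have csq_gp N : (csq (fun z => g z - p z)%R <= (d + e N)%:E)%E.
  apply: (pP _ _ N (L2_mble lg)) => n Nn; rewrite -sqnE// lee_fin.
  by apply: le_trans (hP n).2 _; rewrite lerD2l e_le.
have lgp : L2 (fun z => g z - p z).
  apply/L2P; split; first exact/mbleB/mp/L2_mble.
  by apply: le_lt_trans (csq_gp 0%N) _; exact: ltry.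
have lp : L2 p.
  have := L2B lg lgp; congr L2; apply/funext => z; ring.
(* The limit lemma is now used with [h n] in place of [g], along the tail starting at [n]. *)
have sqn_hp n : sqn (fun z => h n z - p z) <= 4 * e n.
  rewrite -lee_fin sqnE; last exact: L2B.
  apply: (pP _ _ n (L2_mble (lh n))) => m nm; rewrite -sqnE; last exact: L2B.
  by rewrite lee_fin; apply: le_trans (dist _ _) _; have := e_le _ _ nm; lra.
have e_small (x : R) : 0 < x -> exists n, e n < x.
  move=> x0; have /cvgr_lt/(_ _ x0) : geometric (1 : R) 8^-1 @ \oo --> (0 : R).
    by apply: cvg_geometric; rewrite ger0_norm// invf_lt1// ltr1n.
  move=> [n _ /(_ _ (leqnSn n))] /=; rewrite mul1r => en; by exists n.
have gp_d : sqn (fun z => g z - p z) <= d.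
  apply/ler_addgt0Pr => x /e_small[n nx].
  have := csq_gp n; rewrite -sqnE// lee_fin => /le_trans; apply.
  by rewrite lerD2l ltW.
have Mp : M p.
  apply: Mcl => // x x0.
  have [n nx] : exists n, e n < x ^+ 2 / 4.
    by apply: e_small; rewrite divr_gt0// exprn_gt0.
  exists (h n); first exact: (hP n).1.
  rewrite /norm2 -/(sqn (p \- h n)) -[ltRHS]ger0_norm ?ltW// -sqrtr_sqr.
  rewrite ltr_sqrt ?exprn_gt0//.
  have -> : p \- h n = (fun z => - (h n z - p z)).
    by apply/funext => z; rewrite opprB.
  by rewrite sqnN; apply: le_lt_trans (sqn_hp n) _; lra.
(* If [inner (g \- p) k] were nonzero, moving [p] along [k] inside [M] would bring the squared
   distance below [d], by [sqn_sub_le]. *)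
exists p => // k Mk; have lk := ML _ Mk.
have s0 : 0 < (sqn k + 1)^-1 by rewrite invr_gt0 ltr_wpDl// sqn_ge0.
apply/eqP; rewrite -nsq_eq0 eq_le nsq_ge0 andbT -(pmulr_rle0 _ s0).
have := sqn_sub_le lgp lk.
set c := _ * inner _ _.
have Mpk : M (fun z => p z + c * k z).
  have := Mlin c _ _ Mk Mp; congr M; apply/funext => z; exact: addrC.
have := d_le _ Mpk.
have -> : (fun z => g z - (p z + c * k z)) = (fun z => g z - p z - c * k z).
  by apply/funext => z; rewrite opprD addrA.
lra.
Qed.

End Hilbert.

(** * The Hardy space, its multipliers, and division by Blaschke denominators *)

Section Hardy.
Variable R : realType.
Implicit Types (f g h p F : cfun R).
Local Notation mu := (@arc_measure R).

Lemma H2_L2 f : H2 f -> L2 f. Proof. by case. Qed.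

Lemma H2E : @H2 R =
  perp [set (fun z : circle R => val z ^ k) | k in [set k : int | k < 0]].
Proof.
apply/seteqP; split=> f [lf f0]; split=> //.
  by move=> _ [k k0 <-]; exact: f0.
by move=> k k0; apply: f0; exists k.
Qed.

Lemma H2_closed_subspace : closed_subspace (@H2 R).
Proof.
by rewrite H2E; apply: perp_closed_subspace => _ [k _ <-]; exact: L2_exp.
Qed.

Lemma H2_linear (c : R[i]) f g : H2 f -> H2 g -> H2 (fun z => c * f z + g z).
Proof. by case: H2_closed_subspace => _ _ + _; exact. Qed.

Lemma H20 : H2 (fun _ : circle R => 0).
Proof. by case: H2_closed_subspace. Qed.

Lemma H2Z (c : R[i]) f : H2 f -> H2 (fun z => c * f z).
Proof. exact: closed_subspaceZ H2_closed_subspace. Qed.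

Lemma H2D f g : H2 f -> H2 g -> H2 (fun z => f z + g z).
Proof.
move=> hf hg; have := H2_linear 1 hf hg.
by congr H2; apply/funext => z; rewrite mul1r.
Qed.

Lemma H2B f g : H2 f -> H2 g -> H2 (fun z => f z - g z).
Proof. exact: closed_subspaceB H2_closed_subspace. Qed.

Lemma H2_sum (I : finType) (G : I -> cfun R) :
  (forall i, H2 (G i)) -> H2 (fun z => \sum_i G i z).
Proof.
move=> hG; elim: (index_enum I) => [|i s ih].
  by under eq_fun do rewrite big_nil; exact: H20.
by under eq_fun do rewrite big_cons; exact: H2D.
Qed.

Lemma H2_aeq f g : L2 g -> aeq f g -> H2 f -> H2 g.
Proof.
move=> lg fg [lf f0]; split=> // k /f0 <-.
by apply/esym; apply: inner_aeql => //; exact: L2_exp.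
Qed.

(** Take [h] to be [f]. This reduces almost everywhere equations in [H2] to identities between inner
    products. *)
Lemma H2_perp_H2 f : H2 f -> (forall h, H2 h -> inner f h = 0) -> aeq f (cst 0).
Proof.
by move=> hf f0; apply: sqn_eq0; [exact: H2_L2|rewrite /sqn f0].
Qed.

Lemma inner_mulJ g f h :
  inner (fun z => g z * f z) h = inner f (fun z => (g z)^*%R * h z).
Proof.
congr mean; apply/funext => z.
by rewrite rmorphM /= conjCK; ring.
Qed.

Lemma conj_exp (z : circle R) (k : int) : (val z ^ k)^*%R = val z ^ (- k).
Proof.
by rewrite conj_nsq1 ?nsq_exp_circle// invr_expz.
Qed.

Lemma fourier_shift f (k : int) :
  fourier (fun z => val z * f z) k = fourier f (k - 1).
Proof.
congr mean; apply/funext => z; rewrite !conj_exp opprB addrC.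
by rewrite exprzDr ?unitfE ?circle_neq0// expr1z; ring.
Qed.

Lemma sqn_exp (k : int) : sqn (fun z : circle R => val z ^ k) = 1.
Proof.
apply/EFin_inj; rewrite sqnE; last exact: L2_exp.
rewrite /csq; under eq_integral => t _.
  by rewrite nsq_exp_circle; over.
by rewrite integral_cst// [X in (_ * X)%E]arc_measureT mule1.
Qed.

Lemma H2_mul_val f : H2 f -> H2 (fun z => val z * f z).
Proof.
move=> [lf f0]; split; first exact: L2_Bdd (Bdd_val R) lf.
move=> k k0; rewrite fourier_shift f0//.
by rewrite (lt_trans _ k0)// ltrBlDr ltrDl.
Qed.

Lemma H2_mul_affine (b c : R[i]) f : H2 f ->
  H2 (fun z => (b + c * val z) * f z).
Proof.
move=> hf; have := H2_linear b hf (H2Z c (H2_mul_val hf)).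
by congr H2; apply/funext => z; rewrite mulrDl mulrA.
Qed.

Lemma L2_mul_affine (b c : R[i]) f : L2 f ->
  L2 (fun z => (b + c * val z) * f z).
Proof.
move=> lf; have := L2D (L2Z b lf) (L2Z c (L2_Bdd (Bdd_val R) lf)).
by congr L2; apply/funext => z; rewrite mulrDl mulrA.
Qed.

Lemma fourier_div_affine (b : R[i]) f (k : int) : L2 f ->
  fourier (fun z => (1 - b * val z) * f z) k =
  fourier f k - b * fourier f (k - 1).
Proof.
move=> lf; have lvf := L2_Bdd (Bdd_val R) lf.
rewrite -fourier_shift /fourier.
have le := @L2_exp R k.
rewrite -(innerZl b lvf le) -(innerBl lf (L2Z b lvf) le).
by congr inner; apply/funext => z; ring.
Qed.

(* If [(1 - b z) f] is analytic, the negative Fourier coefficients of [f]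
   satisfy [c k = b * c (k - 1)]; they are bounded, so [|b| < 1] forces them
   to vanish. *)
Lemma H2_div_affine (b : R[i]) f : nsq b < 1 -> L2 f ->
  H2 (fun z => (1 - b * val z) * f z) -> H2 f.
Proof.
move=> b1 lf [_ f0]; split=> // k k0.
have rec m : fourier f k = b ^+ m * fourier f (k - m%:Z).
  elim: m => [|m ->]; first by rewrite expr0 mul1r subr0.
  have := f0 (k - m%:Z); rewrite fourier_div_affine// => /(_ _)/eqP.
  rewrite subr_eq0 => /(_ _)/eqP ->; last first.
    by apply: le_lt_trans k0; rewrite gerBl.
  by rewrite exprSr -mulrA -addrA -opprD -PoszD addn1.
(* The factor 2 is the [sqn k + 1] of [CauchySchwarz_weak] for a unit vector. *)
have bound m : nsq (fourier f k) <= 2 * sqn f * nsq b ^+ m.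
  rewrite (rec m) nsqM nsqX mulrC.
  rewrite ler_wpM2r ?exprn_ge0 ?nsq_ge0//.
  by apply: le_trans (CauchySchwarz_weak lf (L2_exp R _)) _; rewrite sqn_exp.
apply/eqP; rewrite -nsq_eq0 eq_le nsq_ge0 andbT.
have : geometric (2 * sqn f) (nsq b) @ \oo --> (0 : R).
  by apply: cvg_geometric; rewrite ger0_norm ?nsq_ge0.
by move/cvgr_to_ge; apply; apply: nearW => m; exact: bound.
Qed.

(** The product runs over a list so that one factor of a Blaschke numerator can be left out. *)
Lemma H2_prod_mul (I : Type) (s : seq I) (b : I -> R[i]) f : H2 f ->
  H2 (fun z => \prod_(i <- s) (b i - val z) * f z).
Proof.
move=> hf; elim: s => [|i s ih].
  by under eq_fun do rewrite big_nil mul1r.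
have := H2_mul_affine (b i) (-1) ih.
by congr H2; apply/funext => z; rewrite big_cons mulN1r mulrA.
Qed.

Lemma L2_prod_mul (I : Type) (s : seq I) (b : I -> R[i]) f : L2 f ->
  L2 (fun z => \prod_(i <- s) (1 - b i * val z) * f z).
Proof.
move=> lf; elim: s => [|i s ih].
  by under eq_fun do rewrite big_nil mul1r.
have := L2_mul_affine 1 (- b i) ih.
by congr L2; apply/funext => z; rewrite big_cons mulNr mulrA.
Qed.

Lemma H2_prod_div (I : Type) (s : seq I) (b : I -> R[i]) f :
  (forall i, nsq (b i) < 1) -> L2 f ->
  H2 (fun z => \prod_(i <- s) (1 - b i * val z) * f z) -> H2 f.
Proof.
move=> b1 lf; elim: s => [|i s ih] hs.
  by move: hs; congr H2; apply/funext => z; rewrite big_nil mul1r.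
apply: ih; apply: (H2_div_affine (b1 i)); first exact: L2_prod_mul.
by move: hs; congr H2; apply/funext => z; rewrite big_cons mulrA.
Qed.

Lemma nsq_lt1 (c : R[i]) : `|c| < 1 -> nsq c < 1.
Proof.
move=> c1; rewrite -ltcR nsqE -sqr_normc.
by rewrite -[1%:C]/(1 : R[i]) expr_lt1.
Qed.

Lemma BH2_mul_val n (a : 'I_n -> R[i]) f :
  BH2 a f -> BH2 a (fun z => val z * f z).
Proof.
move=> [lf [h hh fBh]]; split; first exact: L2_Bdd (Bdd_val R) lf.
exists (fun z => val z * h z); first exact: H2_mul_val.
by apply: filterS fBh => t /= ->; rewrite mulrCA.
Qed.

(** The factor of the Blaschke product at [a j = 0] is -z, which conj z cancels on the circle. After
    multiplication by the denominators, what remains is a polynomial times [h], and [H2_prod_div]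
    removes the denominators. *)
Lemma BH2_div_val n (a : 'I_n -> R[i]) f : (forall k, `|a k| < 1) ->
  (exists j, a j = 0) -> BH2 a f -> H2 (fun z => (val z)^*%R * f z).
Proof.
move=> a1 [j aj] [lf [h hh fBh]].
have lzf : L2 (fun z => (val z)^*%R * f z).
  exact: L2_Bdd (BddJ (Bdd_val R)) lf.
have b1 i : nsq ((a i)^*%R) < 1 by rewrite nsqJ; exact/nsq_lt1.
apply: (@H2_prod_div _ (index_enum 'I_n) (fun k => (a k)^*%R)) => //.
(* The sign -1 comes from [a j - z] being -z. *)
have := H2Z (-1) (H2_prod_mul [seq k <- index_enum 'I_n | k != j] a hh).
apply: H2_aeq; first exact: L2_prod_mul.
apply: filterS fBh => t ->; move: (expi t) => {t} z.
have z0 := circle_neq0 z.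
rewrite /blaschke prodf_div conj_circle.
(* A vanishing factor would force [nsq] of the conjugate of [a k] to be 1. *)
have Q0 : \prod_(k < n) (1 - (a k)^*%R * val z) != 0.
  apply/prodf_neq0 => k _; apply/eqP => /eqP; rewrite subr_eq0 => /eqP az.
  have := congr1 (@nsq R) az; rewrite nsq1 nsqM nsq_circle mulr1 => ak1.
  by have := b1 k; rewrite -ak1 ltxx.
move: (val z) z0 Q0 => w w0 Q0.
rewrite big_filter [X in X / _](bigD1 j)//= aj sub0r.
by field; apply/andP.
Qed.

End Hardy.

(** * Toeplitz operators, the adjoint shift, and the perturbed kernel *)

Section ToeplitzPerturbation.
Variable R : realType.
Implicit Types (f g h p F : cfun R).

(** Existence of a projection ensures that [xget] does not fall back on its default value. *)
Lemma H2projP g : L2 g -> is_H2proj g (H2proj g).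
Proof.
move=> lg; have [p Hp gp] := projection_exists (H2_closed_subspace R) lg.
by apply: (xgetPex (cst 0)); exists p.
Qed.

(** The projection of (conj z) f onto [H2] satisfies the adjoint identity, so [xget] has a value to
    choose. *)
Lemma Tz_adjP f : L2 f -> is_adjoint_at (@Tz R) f (Tz_adj f).
Proof.
move=> lf; apply: (xgetPex (cst 0)).
have lzf : L2 (fun z => (val z)^*%R * f z).
  exact: L2_Bdd (BddJ (Bdd_val R)) lf.
have [Hp gp] := H2projP lzf.
exists (H2proj (fun z => (val z)^*%R * f z)); split=> // h hh.
have lh := H2_L2 hh; have lp := H2_L2 Hp.
rewrite inner_mulJ; apply/eqP; rewrite -subr_eq0; apply/eqP.
apply: (inv_inj (@conjCK R[i])); rewrite rmorphB rmorph0 /=.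
by rewrite -!innerC// -innerBl//; exact: gp.
Qed.

Lemma H2_Tz_adj f : L2 f -> H2 (Tz_adj f).
Proof. by move=> /Tz_adjP[]. Qed.

Lemma inner_Tz_adj f h : L2 f -> H2 h ->
  inner h (Tz_adj f) = inner (fun z => val z * h z) f.
Proof. by move=> /Tz_adjP[_ adj] hh; rewrite -adj. Qed.

(** Both sides lie in [H2] and have the same inner products with all of [H2]. *)
Lemma Tz_adj_aeq f : L2 f -> H2 (fun z => (val z)^*%R * f z) ->
  aeq (Tz_adj f) (fun z => (val z)^*%R * f z).
Proof.
move=> lf hf; have ha := H2_Tz_adj lf.
have la := H2_L2 ha; have lzf := H2_L2 hf.
have : aeq (fun z => Tz_adj f z - (val z)^*%R * f z) (cst 0).
  apply: H2_perp_H2; first exact: H2B.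
  move=> h hh; have lh := H2_L2 hh.
  rewrite innerBl// (innerC lh la) (innerC lh lzf) inner_Tz_adj//.
  by rewrite inner_mulJ subrr.
by apply: filterS => t /= /eqP; rewrite subr_eq0 => /eqP.
Qed.

Variables (n : nat) (phi : cfun R) (f : 'I_n -> cfun R).
Hypotheses (phi_bdd : Bdd phi) (Hf : forall i, H2 (f i)).

Let A g : cfun R := toeplitz phi g \+
  (fun z => \sum_(i < n) tensor (f i) (Tz_adj (f i)) g z).

Lemma H2_perturbation g : H2 g -> H2 (A g).
Proof.
move=> Hg; have [Ht _] := H2projP (L2_Bdd phi_bdd (H2_L2 Hg)).
by apply: H2D => //; apply: H2_sum => i; exact: H2Z.
Qed.

Lemma inner_perturbation g h : H2 g -> H2 h ->
  inner (A g) h = inner (fun z => phi z * g z) h +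
    \sum_i inner g (Tz_adj (f i)) * inner (f i) h.
Proof.
move=> Hg Hh; have lh := H2_L2 Hh.
have lpg := L2_Bdd phi_bdd (H2_L2 Hg).
have [Ht tP] := H2projP lpg; have lt := H2_L2 Ht.
have Ls i : L2 (tensor (f i) (Tz_adj (f i)) g) by exact/L2Z/H2_L2.
rewrite innerDl//; last exact: L2_sum.
congr (_ + _).
  by apply/esym/eqP; rewrite -subr_eq0 -innerBl//; apply/eqP; exact: tP.
rewrite inner_suml//; apply: eq_bigr => i _.
by rewrite innerZl//; exact: H2_L2.
Qed.

(** Since [A g] lies in [H2], its vanishing can be tested against [H2], where the projection inside
    [toeplitz] disappears. *)
Lemma kernel_perturbationP g : kernel_on_H2 A g <->
  H2 g /\ forall h, H2 h -> inner (fun z => phi z * g z) h +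
    \sum_i inner g (Tz_adj (f i)) * inner (f i) h = 0.
Proof.
split=> -[Hg Ag]; split=> //.
  move=> h Hh; rewrite -inner_perturbation// -(inner0l h).
  apply: inner_aeql => //; [|exact: L2_cst|]; last exact: H2_L2.
  exact/H2_L2/H2_perturbation.
apply: H2_perp_H2; first exact: H2_perturbation.
by move=> h Hh; rewrite inner_perturbation// Ag.
Qed.

Lemma kernel_perturbation_closed : closed_subspace (kernel_on_H2 A).
Proof.
(* Up to projection onto [H2], this is the adjoint of [A] at [h]; the conjugated coefficient is <h,
   f_i>. *)
pose w h : cfun R := fun z => (phi z)^*%R * h z +
  \sum_i (inner (f i) h)^*%R * Tz_adj (f i) z.
have Lw1 h : H2 h -> L2 (fun z => (phi z)^*%R * h z).
  by move=> /H2_L2; exact/L2_Bdd/BddJ.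
have LT i : L2 (Tz_adj (f i)) by exact/H2_L2/H2_Tz_adj/H2_L2.
have Lw2 h : L2 (fun z => \sum_i (inner (f i) h)^*%R * Tz_adj (f i) z).
  by apply: L2_sum => i; exact: L2Z.
have wE g h : L2 g -> H2 h -> inner g (w h) =
    inner (fun z => phi z * g z) h +
    \sum_i inner g (Tz_adj (f i)) * inner (f i) h.
  move=> lg Hh; rewrite innerDr//; last exact: Lw1.
  rewrite inner_mulJ; congr (_ + _).
  rewrite innerC// inner_suml//; last by move=> i; exact: L2Z.
  rewrite rmorph_sum /=; apply: eq_bigr => i _.
  by rewrite -innerC ?innerZr//; [rewrite conjCK mulrC|exact: L2Z].
(* Orthogonality to the negative powers gives membership in [H2], and orthogonality to the [w h]
   gives the kernel equation. *)
pose S : set (cfun R) :=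
  [set (fun z : circle R => val z ^ k) | k in [set k : int | k < 0]] `|`
  [set w h | h in @H2 R].
have -> : kernel_on_H2 A = perp S.
  apply/seteqP; split=> g.
    move=> /kernel_perturbationP[Hg gw]; split; first exact: H2_L2.
    move=> _ [[k k0 <-]|[h Hh <-]]; first exact: Hg.2.
    by rewrite wE ?gw//; exact: H2_L2.
  move=> [lg gS]; have Hg : H2 g.
    by rewrite H2E; split=> // v Sv; apply: gS; left.
  apply/kernel_perturbationP; split=> // h Hh.
  by rewrite -wE//; apply: gS; right; exists h.
apply: perp_closed_subspace => _ [[k _ <-]|[h Hh <-]]; first exact: L2_exp.
by apply: L2D => //; exact: Lw1.
Qed.

End ToeplitzPerturbation.

(** * Near invariance of the kernel *)

Theorem theorem7p1 (R : realType) (n : nat) (a : 'I_n -> R[i])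
  (a_disc : forall k, `|a k| < 1) (a_zero : exists j, a j = 0)
  (phi : cfun R) (phi_Linfty : Linfty phi)
  (f : 'I_n -> cfun R) (f_basis : orthonormal_basis (model_space a) f) :
  nearly_invariant a
    (kernel_on_H2 (fun g : cfun R =>
       toeplitz phi g \+
       (fun z => \sum_(i < n) tensor (f i) (Tz_adj (f i)) g z))).
Proof.
have phi_bdd := Linfty_Bdd phi_Linfty.
case: f_basis => f_model _ _.
have Hf i : H2 (f i) by case: (f_model i).
have kerP := kernel_perturbationP phi_bdd Hf.
split; first exact: kernel_perturbation_closed.
  by move=> g /kerP[].
move=> g /kerP[Hg gP] Bg.
have lg := H2_L2 Hg; have lf i := H2_L2 (Hf i).
have perpB u i : BH2 a u -> L2 u -> inner u (f i) = 0.
  by move=> Bu lu; rewrite innerC// (f_model i).2// rmorph0.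
have Hzg := BH2_div_val a_disc a_zero Bg.
have Hz := H2_Tz_adj lg; have gz := Tz_adj_aeq lg Hzg.
have lz := H2_L2 Hz; have lzg := H2_L2 Hzg.
apply/kerP; split=> // h Hh; have lh := H2_L2 Hh.
rewrite big1 ?addr0 => [|i _].
  (* Isolating conj z lets it move to the other side of the inner product, where it becomes z h. *)
  have -> : inner (fun z => phi z * Tz_adj g z) h =
      inner (fun z => (val z)^*%R * (phi z * g z)) h.
    apply: inner_aeql => //; try exact: L2_Bdd.
      by apply: L2_Bdd (BddJ (Bdd_val R)) _; exact: L2_Bdd.
    by apply: filterS gz => t ->; rewrite mulrCA.
  rewrite inner_mulJ; under [X in inner _ X]eq_fun do rewrite conjCK.
  (* The kernel equation of [g] is tested against z h; its finite-rank part vanishes because z g is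
     orthogonal to every [f i]. *)
  have := gP _ (H2_mul_val Hh); rewrite big1 ?addr0// => i _.
  rewrite inner_Tz_adj// perpB ?mul0r//; first exact: BH2_mul_val.
  exact: H2_L2 (H2_mul_val Hg).
rewrite inner_Tz_adj//.
(* Multiplying (conj z) g by z gives back g on the circle. *)
have -> : inner (fun z => val z * Tz_adj g z) (f i) = inner g (f i).
  apply: inner_aeql => //; first exact: L2_Bdd (Bdd_val R) lz.
  apply: filterS gz => t ->.
  by rewrite mulrA -nsqE nsq_circle mul1r.
by rewrite perpB ?mul0r.
Qed.
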